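(* Let $\phi:\mathbb R^n\to\overline{\mathbb R}$ be a distance generating function, $X=\operatorname{dom}\phi$, $Y=\operatorname{int}\operatorname{dom}\phi$. Given $g:Y\to\overline{\mathbb R}$, let $g_{\nabla\phi}:\mathbb R^n\to\overline{\mathbb R}$ be its epi-composition by $\nabla\phi$. For any $\lambda>0$ the following hold: (i) $\lambda\,\overrightarrow{\mathrm{env}}_\lambda g=\bigl[\phi-(\phi^*+\lambda g_{\nabla\phi})^*\bigr]\big|_X$. (ii) $\nabla\phi\circ\overrightarrow{\mathrm{prox}}_{\lambda g}(x)=\bigl(\partial^F(\phi^*+\lambda g_{\nabla\phi})\bigr)^{-1}(x)$ for $x\in X$. In particular, when $\phi$ is Legendre, $\overrightarrow{\mathrm{prox}}_{\lambda g}=\nabla\phi^*\circ\bigl(\partial^F(\phi^*+\lambda\, g\circ\nabla\phi^* )\bigr)^{-1}$ on $X$. (iii) On $Y$, $$\lambda\,\overrightarrow{\mathrm{hull}}_\lambda g=\Bigl(\bigl[(\phi^*+\lambda g_{\nabla\phi})^*+\delta_X\bigr]^*-\phi^*\Bigr)\circ\nabla\phi\ \le\ \bigl(\overline{\mathrm{conv}}(\phi^*+\lambda g_{\nabla\phi})-\phi^*\bigr)\circ\nabla\phi\ \le\ \bigl(\mathrm{conv}(\phi^*+\lambda g_{\nabla\phi})-\phi^*\bigr)\circ\nabla\phi\ \le\ \lambda g.$$ If $\operatorname{dom}\phi=\mathbb R^n$ (i.e. $X=Y=\mathbb R^n$), then the first inequality is an equality.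
   Context: $\overline{\mathbb R}=\mathbb R\cup\{\pm\infty\}$. A distance generating function (dgf) is a proper, lsc, convex function $\phi:\mathbb R^n\to\overline{\mathbb R}$ that is differentiable on $\operatorname{int}\operatorname{dom}\phi\neq\emptyset$. The Bregman distance is $D_\phi(x,y)=\phi(x)-\phi(y)-\langle\nabla\phi(y),x-y\rangle$ for $y\in Y$, and $\infty$ otherwise. $\phi$ is Legendre if it is essentially smooth (differentiable on $\operatorname{int}\operatorname{dom}\phi\ne\emptyset$ with $\|\nabla\phi(x^k)\|\to\infty$ whenever $\operatorname{int}\operatorname{dom}\phi\ni x^k\to x\in\operatorname{bdry}\operatorname{dom}\phi$) and essentially strictly convex (strictly convex on every convex subset of $\operatorname{dom}\partial\phi$); then $\nabla\phi:Y\to\operatorname{int}\operatorname{dom}\phi^*$ is a bijection with inverse $\nabla\phi^*$. Fenchel conjugate: $h^*(y)=\sup_{x\in\mathbb R^n}\{\langle x,y\rangle-h(x)\}$. $\delta_X$ is the indicator function ($0$ on $X$, $\infty$ elsewhere; $h+\delta_X$ means the function equal to $h$ on $X$ and $\infty$ off $X$). For $g:Y\to\overline{\mathbb R}$ and $f:X\to\overline{\mathbb R}$, and $\lambda>0$: $\overrightarrow{\mathrm{prox}}_{\lambda g}(x)=\operatorname{argmin}_{y\in Y}\{g(y)+\frac1\lambda D_\phi(x,y)\}$ and $\overrightarrow{\mathrm{env}}_\lambda g(x)=\inf_{y\in Y}\{g(y)+\frac1\lambda D_\phi(x,y)\}$ for $x\in X$; $\overleftarrow{\mathrm{env}}_\lambda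 f(y)=\inf_{x\in X}\{f(x)+\frac1\lambda D_\phi(x,y)\}$ for $y\in Y$; the right Bregman proximal hull is $\overrightarrow{\mathrm{hull}}_\lambda g=-\overleftarrow{\mathrm{env}}_\lambda(-\overrightarrow{\mathrm{env}}_\lambda g):Y\to\overline{\mathbb R}$. Epi-composition: $g_{\nabla\phi}(\xi)=\inf_{y\in Y}\{g(y):\nabla\phi(y)=\xi\}$ for $\xi\in\mathbb R^n$ ($=\infty$ if $\xi\notin\operatorname{range}\nabla\phi$). When $\phi$ is Legendre it equals $g\circ\nabla\phi^*$ on $\operatorname{int}\operatorname{dom}\phi^*$ and $\infty$ elsewhere; in (ii) $g\circ\nabla\phi^*$ is understood as this function on $\mathbb R^n$. Fenchel subdifferential of $h:\mathbb R^n\to\overline{\mathbb R}$: $\partial^Fh(\xi)=\{u: h(\xi')\ge h(\xi)+\langle u,\xi'-\xi\rangle\ \forall\xi'\in\mathbb R^n\}$, and $(\partial^Fh)^{-1}(x)=\{\xi:x\in\partial^Fh(\xi)\}$. $\mathrm{conv}\,h$ is the pointwise supremum of all convex functions majorized by $h$, and $\overline{\mathrm{conv}}\,h$ the pointwise supremum of all convex lsc functions majorized by $h$.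
   Formalization: The first equality of (ii) fails in general (φ=0, g=exp); its right side is cut to points where the infimum defining g_{∇φ} is attained. In (iii), conv and closed conv use convex functions with values in ]-∞,+∞]. In the Legendre formula ∇φ* is applied only on int dom φ*. *)

(* Defs.v *)
From HB Require Import structures.
From mathcomp Require Import all_boot all_order all_algebra.
From mathcomp Require Import all_classical all_reals all_analysis.

Set Implicit Arguments.
Unset Strict Implicit.
Unset Printing Implicit Defensive.

Import Order.TTheory GRing.Theory Num.Theory.
Import numFieldNormedType.Exports.

Local Open Scope classical_set_scope.
Local Open Scope ring_scope.
Local Open Scope ereal_scope.

(* Functions on X or Y are represented by functions on the whole space ['rV_n];
   every definition below only uses their values on X, respectively Y. *)

Definition dotv (R : realType) (n : nat) (u v : 'rV[R]_n) : R :=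
  (u *m v^T) ord0 ord0.

Definition dom (R : realType) (n : nat) (h : 'rV[R]_n -> \bar R)
  : set 'rV[R]_n := [set x | h x < +oo].

Definition int_dom (R : realType) (n : nat) (h : 'rV[R]_n -> \bar R)
  : set 'rV[R]_n := (dom h)°.

Definition proper (R : realType) (n : nat) (h : 'rV[R]_n -> \bar R) : Prop :=
  (forall x, -oo < h x) /\ dom h !=set0.

(* Only applied to functions that never take the value -oo, so that no
   oo - oo occurs on the right-hand side. *)
Definition convex_fun (R : realType) (n : nat) (h : 'rV[R]_n -> \bar R)
  : Prop :=
  forall (x y : 'rV[R]_n) (t : R), (0 <= t <= 1)%R ->
    h (t *: x + (1 - t) *: y)%R <= t%:E * h x + (1 - t)%:E * h y.

Definition strictly_convex_on (R : realType) (n : nat) (C : set 'rV[R]_n)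
    (h : 'rV[R]_n -> \bar R) : Prop :=
  forall (x y : 'rV[R]_n) (t : R), C x -> C y -> x <> y -> (0 < t < 1)%R ->
    h (t *: x + (1 - t) *: y)%R < t%:E * h x + (1 - t)%:E * h y.

(* A proper h is finite around each point of int dom h, hence coincides there
   with the real-valued function [fine \o h]. *)
Definition grad (R : realType) (n : nat) (h : 'rV[R]_n -> \bar R)
    (y : 'rV[R]_n) : 'rV[R]_n :=
  (\row_(i < n) 'd (fine \o h : 'rV[R]_n -> R^o) y (delta_mx ord0 i))%R.

Definition differentiable_on_int_dom (R : realType) (n : nat)
    (h : 'rV[R]_n -> \bar R) : Prop :=
  int_dom h !=set0 /\
  forall y, int_dom h y -> differentiable (fine \o h : 'rV[R]_n -> R^o) y.

Definition dgf (R : realType) (n : nat) (phi : 'rV[R]_n -> \bar R) : Prop :=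
  [/\ proper phi, lower_semicontinuous phi, convex_fun phi
    & differentiable_on_int_dom phi].

Definition fsubdiff (R : realType) (n : nat) (h : 'rV[R]_n -> \bar R)
    (xi : 'rV[R]_n) : set 'rV[R]_n :=
  [set u | forall xi', h xi + (dotv u (xi' - xi)%R)%:E <= h xi'].

Definition fsubdiff_inv (R : realType) (n : nat) (h : 'rV[R]_n -> \bar R)
    (x : 'rV[R]_n) : set 'rV[R]_n :=
  [set xi | fsubdiff h xi x].

(* The norm on ['rV_n] is the sup norm, equivalent to the Euclidean one. *)
Definition essentially_smooth (R : realType) (n : nat)
    (phi : 'rV[R]_n -> \bar R) : Prop :=
  differentiable_on_int_dom phi /\
  forall (u : nat -> 'rV[R]_n) (x : 'rV[R]_n),
    (forall k, int_dom phi (u k)) ->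
    (closure (dom phi) `\` int_dom phi) x ->
    u @ \oo --> x ->
    (fun k => `|grad phi (u k)|%R) @ \oo --> +oo%R.

Definition essentially_strictly_convex (R : realType) (n : nat)
    (phi : 'rV[R]_n -> \bar R) : Prop :=
  forall C : set 'rV[R]_n,
    convex_set C -> C `<=` [set x | fsubdiff phi x !=set0] ->
    strictly_convex_on C phi.

Definition legendre (R : realType) (n : nat) (phi : 'rV[R]_n -> \bar R)
  : Prop :=
  essentially_smooth phi /\ essentially_strictly_convex phi.

Definition bregman (R : realType) (n : nat) (phi : 'rV[R]_n -> \bar R)
    (x y : 'rV[R]_n) : \bar R :=
  if y \in int_dom phi then
    phi x - phi y - (dotv (grad phi y) (x - y)%R)%:E
  else +oo.

Definition fconj (R : realType) (n : nat) (h : 'rV[R]_n -> \bar R)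
    (y : 'rV[R]_n) : \bar R :=
  ereal_sup (range (fun x => (dotv x y)%:E - h x)).

Definition restr (R : realType) (n : nat) (X : set 'rV[R]_n)
    (h : 'rV[R]_n -> \bar R) (x : 'rV[R]_n) : \bar R :=
  if x \in X then h x else +oo.

Definition argmin (R : realType) (T : Type) (A : set T) (F : T -> \bar R)
  : set T :=
  [set y | A y /\ forall z, A z -> F y <= F z].

Definition right_prox (R : realType) (n : nat) (phi : 'rV[R]_n -> \bar R)
    (lam : R) (g : 'rV[R]_n -> \bar R) (x : 'rV[R]_n) : set 'rV[R]_n :=
  argmin (int_dom phi) (fun y => g y + lam^-1%:E * bregman phi x y).

Definition right_env (R : realType) (n : nat) (phi : 'rV[R]_n -> \bar R)
    (lam : R) (g : 'rV[R]_n -> \bar R) (x : 'rV[R]_n) : \bar R :=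
  ereal_inf [set g y + lam^-1%:E * bregman phi x y | y in int_dom phi].

Definition left_env (R : realType) (n : nat) (phi : 'rV[R]_n -> \bar R)
    (lam : R) (f : 'rV[R]_n -> \bar R) (y : 'rV[R]_n) : \bar R :=
  ereal_inf [set f x + lam^-1%:E * bregman phi x y | x in dom phi].

Definition right_hull (R : realType) (n : nat) (phi : 'rV[R]_n -> \bar R)
    (lam : R) (g : 'rV[R]_n -> \bar R) (y : 'rV[R]_n) : \bar R :=
  - left_env phi lam (fun x => - right_env phi lam g x) y.

Definition epi_comp (R : realType) (n : nat) (phi : 'rV[R]_n -> \bar R)
    (g : 'rV[R]_n -> \bar R) (xi : 'rV[R]_n) : \bar R :=
  ereal_inf [set g y | y in [set y | int_dom phi y /\ grad phi y = xi]].

(* The points at which the infimum defining [epi_comp] is a minimum. *)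
Definition epi_comp_attained (R : realType) (n : nat)
    (phi : 'rV[R]_n -> \bar R) (g : 'rV[R]_n -> \bar R) : set 'rV[R]_n :=
  [set xi | exists y,
    [/\ int_dom phi y, grad phi y = xi & g y = epi_comp phi g xi]].

Definition comp_grad_conj (R : realType) (n : nat)
    (phi : 'rV[R]_n -> \bar R) (g : 'rV[R]_n -> \bar R) (xi : 'rV[R]_n)
  : \bar R :=
  if xi \in int_dom (fconj phi) then g (grad (fconj phi) xi) else +oo.

(* In both hulls "convex function" means a convex function with values in
   ]-oo, +oo]; a function without such a minorant has hull -oo (supremum of
   the empty family). If lsc convex functions could take the value -oo, the
   closed hull could differ from the biconjugate: the function equal to -oo
   at 0 and to +oo elsewhere would be its own hull. *)
Definition conv_hull (R : realType) (n : nat) (h : 'rV[R]_n -> \bar R)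
    (xi : 'rV[R]_n) : \bar R :=
  ereal_sup [set q xi | q in
    [set q : 'rV[R]_n -> \bar R |
      [/\ forall z, -oo < q z, convex_fun q & forall z, q z <= h z]]].

Definition closed_conv_hull (R : realType) (n : nat)
    (h : 'rV[R]_n -> \bar R) (xi : 'rV[R]_n) : \bar R :=
  ereal_sup [set q xi | q in
    [set q : 'rV[R]_n -> \bar R |
      [/\ forall z, -oo < q z, convex_fun q, lower_semicontinuous q
        & forall z, q z <= h z]]].

(* Main.v *)
Require Import Defs.
From HB Require Import structures.
From mathcomp Require Import all_boot all_order all_algebra.
From mathcomp Require Import all_classical all_reals all_analysis.
From mathcomp Require Import ring lra.

Set Implicit Arguments.
Unset Strict Implicit.
Unset Printing Implicit Defensive.

Import Order.TTheory GRing.Theory Num.Theory.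
Import numFieldNormedType.Exports.

Local Open Scope classical_set_scope.
Local Open Scope ring_scope.
Local Open Scope ereal_scope.

(** Everything rests on one identity. For y in Y = int dom phi the Fenchel
    equality phi y + phi^* (grad phi y) = <y, grad phi y> turns the Bregman
    distance into
      D x y = phi x + phi^* (grad phi y) - <x, grad phi y>
    ([scaled_bregman_term]). Minimising lam g y + D x y over y in Y is therefore
    maximising <x, xi> - (phi^* + lam g_(grad phi)) xi over xi = grad phi y.
    The optimal value gives the envelope as phi minus a conjugate
    ([scaled_right_env]); the optimality condition is the subgradient
    inequality of the dual sum phi^* + lam g_(grad phi) at xi
    ([grad_right_prox]); applying the same identity once more to the left
    envelope gives the hull ([scaled_right_hull]). As infinite values occur
    throughout, equalities of extended reals are proved by comparing the lower
    bounds of the two sides, where each step is an equivalence of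
    inequalities with a real number moved across.

    The inequalities between hulls hold because the biconjugate is a supremum
    of affine minorants. The reverse inequality for X = R^n is the
    Fenchel-Moreau theorem ([lsc_convex_le_biconj]). It is obtained here from
    proximal points instead of separation: if z minimises
    q + k/2 |. - p|^2 then k (p - z) is a subgradient of q at z, and for k
    large the affine function it defines comes as close to q p as desired
    ([affine_approx]).

    For Legendre phi it has to be shown that grad phi is a bijection from Y
    onto int dom phi^* with inverse grad phi^*. If xi is a subgradient of phi
    at x, essential strict convexity makes x the only minimiser of
    phi - <xi, .>, and this function grows linearly away from x
    ([subdiff_linear_growth]); hence phi^* is finite near xi and
    differentiable there with gradient x ([grad_fconj_subdiff]). Conversely
    each xi in int dom phi^* is a subgradient somewhere, as phi - <xi, .> is
    coercive ([subdiff_inv_exists]), and by essential smoothness a subgradient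
    can only live at interior points of dom phi ([subdiff_int_dom]). Under
    this bijection g_(grad phi) becomes g o grad phi^*, and the general
    description of the proximal map is transported back by grad phi^*
    ([legendre_right_prox]). *)

(** * Inequalities in the reals and the extended reals *)

Section real_bounds.
Context {R : realType}.

(** First-order comparison: after dividing an expansion by t, the remainder t c
    disappears in the limit. *)
Lemma le_of_small_slack (a b c e : R) : (0 < e)%R ->
  (forall t, 0 < t < e -> a <= b + t * c)%R -> (a <= b)%R.
Proof.
move=> e0 H; apply/ler_addgt0Pr => d d0.
have c0 : (0 < `|c| + 1)%R by rewrite ltr_wpDl.
pose t := Num.min (e / 2)%R (d / (`|c| + 1))%R.
have t0 : (0 < t)%R by rewrite lt_min !divr_gt0.
have te : (t < e)%R by rewrite gt_min ltr_pdivrMr// ltr_pMr// ltr1n.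
rewrite (le_trans (H t _)) ?t0// lerD2l (le_trans (ler_norm _))// normrM.
rewrite gtr0_norm// (@le_trans _ _ (t * (`|c| + 1)))%R//.
  by rewrite ler_wpM2l ?lerDl// ltW.
by rewrite -ler_pdivlMr// ge_min lexx orbT.
Qed.

Lemma ereal_realP (x : \bar R) : -oo < x -> x < +oo -> exists r : R, x = r%:E.
Proof. by case: x => // r _ _; exists r. Qed.

Lemma le_ereal_lt_real (A B : \bar R) :
  (forall c : R, c%:E < A -> c%:E <= B) -> A <= B.
Proof.
move=> AB; rewrite leNgt; apply/negP => BA.
suff [c Bc cA] : exists2 c : R, B < c%:E & c%:E < A.
  by have := AB _ cA; rewrite leNgt Bc.
case: A B BA {AB} => [a||] [b||]//=.
- by rewrite lte_fin => /midf_lt[? ?]; eexists; rewrite lte_fin; eassumption.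
- by move=> _; exists (a - 1)%R; rewrite ?ltNyr// lte_fin ltrBlDr ltrDl.
- by move=> _; exists (b + 1)%R; rewrite ?ltry// lte_fin ltrDl.
- by move=> _; exists 0%R; rewrite ?ltNyr ?ltry.
Qed.

(** Reduces an equality possibly involving infinite sums to equivalences between
    inequalities, in which oo - oo never has to be evaluated. *)
Lemma eq_ereal_le (A B : \bar R) : (forall c, c <= A <-> c <= B) -> A = B.
Proof.
by move=> AB; apply/eqP; rewrite eq_le (AB A).1 ?(AB B).2.
Qed.

End real_bounds.

(** * The dot product and the sup norm *)

Section dotv_theory.
Context {R : realType} {n : nat}.
Implicit Types (u v w : 'rV[R]_n) (k : R).
Local Open Scope ring_scope.

Lemma dotvE u v : dotv u v = \sum_i u ord0 i * v ord0 i.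
Proof. by rewrite /dotv mxE; apply: eq_bigr => i _; rewrite mxE. Qed.

Lemma dotvC u v : dotv u v = dotv v u.
Proof. by rewrite !dotvE; apply: eq_bigr => i _; rewrite mulrC. Qed.

Lemma dotvDl u v w : dotv (u + v) w = dotv u w + dotv v w.
Proof. by rewrite /dotv mulmxDl mxE. Qed.

Lemma dotvZl k u v : dotv (k *: u) v = k * dotv u v.
Proof. by rewrite /dotv -scalemxAl mxE. Qed.

Lemma dotvDr u v w : dotv u (v + w) = dotv u v + dotv u w.
Proof. by rewrite dotvC dotvDl !(dotvC u). Qed.

Lemma dotvZr k u v : dotv u (k *: v) = k * dotv u v.
Proof. by rewrite dotvC dotvZl dotvC. Qed.

Lemma dotvNl u v : dotv (- u) v = - dotv u v.
Proof. by rewrite -scaleN1r dotvZl mulN1r. Qed.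

Lemma dotvNr u v : dotv u (- v) = - dotv u v.
Proof. by rewrite dotvC dotvNl dotvC. Qed.

Lemma dotvBl u v w : dotv (u - v) w = dotv u w - dotv v w.
Proof. by rewrite dotvDl dotvNl. Qed.

Lemma dotvBr u v w : dotv u (v - w) = dotv u v - dotv u w.
Proof. by rewrite dotvDr dotvNr. Qed.

Lemma dotv0l v : dotv 0 v = 0.
Proof. by rewrite -(scale0r 0) dotvZl mul0r. Qed.

Lemma coord_le_norm u i : `|u ord0 i| <= `|u|.
Proof.
rewrite [`|u|]mx_normrE.
exact: (le_bigmax _ (fun ij : 'I_1 * 'I_n => `|u ij.1 ij.2|) (ord0, i)).
Qed.

(** The dimension enters because the norm is the sup norm. *)
Lemma normr_dotv_le u v : `|dotv u v| <= n%:R * `|u| * `|v|.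
Proof.
rewrite dotvE (le_trans (ler_norm_sum _ _ _))//.
rewrite -[n in n%:R](card_ord n) -sum1_card natr_sum -mulrA mulr_suml.
by apply: ler_sum => i _; rewrite mul1r normrM ler_pM// coord_le_norm.
Qed.

Lemma dotvv_ge0 u : 0 <= dotv u u.
Proof. by rewrite dotvE sumr_ge0// => i _; rewrite -expr2 sqr_ge0. Qed.

Lemma norm_le_coord u (c : R) :
  0 <= c -> (forall i, `|u ord0 i| <= c) -> `|u| <= c.
Proof.
move=> c0 uc; rewrite [`|u|]mx_normrE.
by apply/bigmax_leP; split => // -[i j] _ /=; rewrite (ord1 i).
Qed.

Lemma sqr_norm_le_dotv u : `|u| ^+ 2 <= dotv u u.
Proof.
rewrite -[leRHS]sqr_sqrtr ?dotvv_ge0// lerXn2r ?nnegrE ?sqrtr_ge0//.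
apply: norm_le_coord => [|i]; first exact: sqrtr_ge0.
rewrite -sqrtr_sqr ler_wsqrtr// dotvE (bigD1 i)//= -expr2 lerDl.
by rewrite sumr_ge0// => j _; rewrite -expr2 sqr_ge0.
Qed.

Lemma dotvv_eq0 u : dotv u u <= 0 -> u = 0.
Proof.
move=> u0; apply/eqP; rewrite -normr_eq0 -sqrf_eq0 eq_le sqr_ge0 andbT.
exact: le_trans (sqr_norm_le_dotv u) u0.
Qed.

Lemma continuous_sum (I : Type) (r : seq I) (F : I -> 'rV[R]_n -> R) :
  (forall i, continuous (F i)) -> continuous (fun v => \sum_(i <- r) F i v).
Proof.
move=> cF.
exact: (@continuous_big R^o _ _ _ _ (@add_continuous R^o) _ _ _
  (fun i _ => cF i)).
Qed.

Lemma dotv_continuous u : continuous (dotv u : 'rV[R]_n -> R).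
Proof.
rewrite (_ : dotv u = fun v => \sum_i u ord0 i * v ord0 i); last first.
  by apply/funext => v; rewrite dotvE.
apply: continuous_sum => i v; apply: cvgMl_tmp;
  [exact: (nbhs_filter v)|exact: (@coord_continuous R 1 n ord0 i v)].
Qed.

Lemma dotvv_continuous : continuous (fun v : 'rV[R]_n => dotv v v).
Proof.
rewrite (_ : (fun v => dotv v v) = fun v => \sum_i v ord0 i * v ord0 i).
  apply: continuous_sum => i v; have ci := @coord_continuous R 1 n ord0 i v.
  by apply: cvgM; [exact: (nbhs_filter v)|exact: ci..].
by apply/funext => v; rewrite dotvE.
Qed.

End dotv_theory.

(** * Lower semicontinuous functions on compact sets *)

Section lsc_minimum.
Local Open Scope ereal_scope.

(** If no minimum is attained, every z in K has some w in K with F w < F z, and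
    then F w < F on a neighbourhood of z. The sublevel sets of F in K generate
    a filter because values are totally ordered, so compactness merges these
    local bounds into one w with F w < F on the whole of K, absurd at w
    itself. *)
Lemma lsc_compact_min (R : realType) (T : topologicalType) (K : set T)
    (F : T -> \bar R) :
  compact K -> K !=set0 -> lower_semicontinuous F ->
  exists2 z, K z & forall w, K w -> F z <= F w.
Proof.
move=> cK [z0 Kz0] lF.
(* The filter generated by the sublevel sets of F in K. *)
pose G : set_system T := [set P | exists2 w, K w &
  forall w', K w' -> F w' <= F w -> P w'].
have filterG : Filter G.
  split=> [|P Q [w Kw wP] [v Kv vQ]|P Q PQ [w Kw wP]]; first by exists z0.
  - have [wv|/ltW vw] := leP (F w) (F v).
      exists w => // w' Kw' w'w; split; [exact: wP|].
      by apply: vQ => //; exact: le_trans wv.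
    exists v => // w' Kw' w'v; split; [|exact: vQ].
    by apply: wP => //; exact: le_trans vw.
  - by exists w => // w' Kw' ?; apply: PQ; exact: wP.
apply: contrapT => nomin.
have lower z : K z -> exists2 w, K w & F w < F z.
  move=> Kz; apply: contrapT => no; apply: nomin; exists z => // w Kw.
  by rewrite leNgt; apply/negP => wz; apply: no; exists w.
have /compact_near_coveringP/(_ _ G (fun w z => F w < F z) filterG) := cK.
case=> [z Kz|w Kw /(_ w Kw (lexx _) w Kw)]; last by rewrite ltxx.
have [w Kw wz] := lower _ Kz.
have [a wa az] : exists2 a : R, F w <= a%:E & a%:E < F z.
  move: wz; case: (F w) => [r wz||]; first by exists r.
    by rewrite ltNge leey.
  case: (F z) => [r _|_|].
  - by exists (r - 1)%R; rewrite ?leNye// lte_fin ltrBlDr ltrDl.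
  - by exists 0%R; rewrite ?leNye ?ltry.
  - by rewrite ltxx.
have [V zV Va] := lF _ _ az.
exists (V, [set w' | K w' /\ F w' <= F w]).
  by split=> //=; exists w.
move=> [z' w'] [/= Vz' [_ w'w]].
by rewrite (le_lt_trans w'w)// (le_lt_trans wa)// Va.
Qed.

Lemma compact_closed_ball (R : realType) (n : nat) (p : 'rV[R]_n) (r : R) :
  compact [set z | `|p - z| <= r]%R.
Proof.
apply: bounded_closed_compact; last exact: closed_closed_ball_.
exists (`|p| + r)%R; split; first exact: num_real.
move=> M prM z /= zr; apply: ltW; apply: le_lt_trans prM.
rewrite -[z](subKr p) (le_trans (ler_normB _ _))// lerD2l.
exact: zr.
Qed.

Lemma lsc_addr_continuous (R : realType) (T : topologicalType)
    (F : T -> \bar R) (G : T -> R) :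
  (forall z, -oo < F z) -> lower_semicontinuous F -> continuous G ->
  lower_semicontinuous (fun z => F z + (G z)%:E).
Proof.
move=> F_ lF cG z a; rewrite -lteBlDr// => aFG.
have [b ab bF] : exists2 b : R, (a - G z < b)%R & b%:E < F z.
  move: aFG (F_ z); case: (F z) => [r|_ _|//]; rewrite -?EFinB ?lte_fin.
    by move=> /midf_lt[? ?] _; eexists; rewrite ?lte_fin; eassumption.
  by exists (a - G z + 1)%R; rewrite ?ltry// ltrDl.
have [V zV Vb] := lF _ _ bF.
have nG : \forall w \near z, (a - b < G w)%R.
  have : (a - b < G z)%R by lra.
  exact: (@cvgr_gt _ _ _ (nbhs_filter z) _ _ (cG z)).
exists (V `&` [set w | (a - b < G w)%R]); first exact: filterI.
move=> w [/Vb bFw /= abG]; rewrite -lteBlDr// (le_lt_trans _ bFw)//.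
by rewrite -EFinB lee_fin; lra.
Qed.

End lsc_minimum.

(** * Fenchel conjugates *)

Section conjugate_bounds.
Context {R : realType} {n : nat}.
Implicit Types (h : 'rV[R]_n -> \bar R) (x u : 'rV[R]_n).

Lemma le_fconj h x u : (dotv x u)%:E - h x <= fconj h u.
Proof. by apply: ereal_sup_ubound; exists x. Qed.

Lemma fconj_leP h u (c : \bar R) :
  fconj h u <= c <-> forall x, (dotv x u)%:E - h x <= c.
Proof.
split=> [hc x|hc]; first by apply: le_trans hc; exact: le_fconj.
by apply/ereal_supP => _ [x _ <-].
Qed.

End conjugate_bounds.

(** * Proximal points of convex functions *)

Section convex_minorants.
Context {R : realType} {n : nat}.
Implicit Types (q h : 'rV[R]_n -> \bar R) (p z w : 'rV[R]_n).

Lemma convex_segment q z w (t : R) : convex_fun q -> (0 <= t <= 1)%R ->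
  q (z + t *: (w - z))%R <= t%:E * q w + (1 - t)%:E * q z.
Proof.
move=> cq t01; have := cq w z t t01; congr (q _ <= _).
by rewrite scalerBr scalerBl scale1r [RHS]addrCA.
Qed.

Lemma convex_addr_affine q (u : 'rV[R]_n) (c : R) : (forall z, -oo < q z) ->
  convex_fun q -> convex_fun (fun z => q z + (dotv u z + c)%:E).
Proof.
move=> q_ cq x y t t01; rewrite !muleDr ?fin_num_adde_defl//.
rewrite addeACA -!EFinM -EFinD leeD//; first exact: cq.
by rewrite lee_fin dotvDr !dotvZr; lra.
Qed.

(** Moving from z towards w by a fraction t, convexity keeps q below its chord
    while the penalty changes by t k <z - p, w - z> up to order t^2; minimality
    divided by t gives the subgradient inequality as t tends to 0. Since
    only small t matter, minimality near z is enough. *)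
Lemma local_min_prox_subdiff q p (k : R) z (e : R) : convex_fun q ->
  (forall z, -oo < q z) -> q z < +oo -> (0 < e)%R ->
  (forall w, (`|w - z| < e)%R ->
    q z + (k / 2 * dotv (z - p) (z - p))%:E <=
    q w + (k / 2 * dotv (w - p) (w - p))%:E) ->
  fsubdiff q z (k *: (p - z))%R.
Proof.
move=> cq q_ qz e0 zmin w.
have [a qza] := ereal_realP (q_ z) qz.
have [->|/negP qw] := eqVneq (q w) +oo; first by rewrite leey.
have [|b qwb] := ereal_realP (q_ w); first by rewrite ltey; exact/negP.
rewrite qza qwb -EFinD lee_fin.
pose N := (`|w - z| + 1)%R.
have N0 : (0 < N)%R by rewrite ltr_wpDl.
apply: (@le_of_small_slack R _ _ (k / 2 * dotv (w - z) (w - z))%R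
  (Num.min 1 (e / N))%R); first by rewrite lt_min ltr01 divr_gt0.
move=> t /andP[t0]; rewrite lt_min => /andP[t1 teN].
have /zmin : (`|z + t *: (w - z) - z| < e)%R.
  rewrite addrAC subrr add0r normrZ gtr0_norm//.
  move: teN; rewrite ltr_pdivlMr//; apply: le_lt_trans.
  by rewrite ler_pM2l// lerDl.
have t01 : (0 <= t <= 1)%R by rewrite !ltW.
move=> /le_trans /(_ (leeD2r _ (convex_segment z w cq t01))).
rewrite qza qwb -!EFinM -!EFinD lee_fin.
have -> : (z + t *: (w - z) - p = (z - p) + t *: (w - z))%R by rewrite addrAC.
rewrite -(opprB z p); move: (w - z)%R (z - p)%R => D E.
rewrite !(dotvDl, dotvDr, dotvZl, dotvZr, dotvNl) (dotvC D E).
set A := dotv E E; set B := dotv E D; set C := dotv D D => H.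
suff : (t * (a + k * - B) <= t * (b + t * (k / 2 * C)))%R by rewrite ler_pM2l.
lra.
Qed.

(** The hypothesis on the sphere pushes the minimum of the penalised function
    over the closed ball into its interior, where it is a local minimum. *)
Lemma prox_point q p (k r : R) z0 : convex_fun q -> lower_semicontinuous q ->
  (forall z, -oo < q z) -> (`|p - z0| <= r)%R -> q z0 < +oo ->
  (forall w, `|p - w|%R = r -> q z0 + (k / 2 * dotv (z0 - p) (z0 - p))%:E <
    q w + (k / 2 * dotv (w - p) (w - p))%:E) ->
  exists z, q z < +oo /\ fsubdiff q z (k *: (p - z))%R.
Proof.
move=> cq lq q_ z0r qz0 sphere.
pose F z := q z + (k / 2 * dotv (z - p) (z - p))%:E.
have lF : lower_semicontinuous F.
  apply: lsc_addr_continuous => // z; apply: cvgMl_tmp.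
    exact: (nbhs_filter z).
  apply: (@continuous_comp _ _ _ (fun z => z - p)%R (fun v => dotv v v)).
    by apply: continuousB => //; exact: cst_continuous.
  exact: dotvv_continuous.
have [|z /= zr zmin] := lsc_compact_min (@compact_closed_ball R n p r) _ lF.
  by exists z0.
have qz : q z < +oo.
  have := zmin z0 z0r; rewrite /F; have [a ->] := ereal_realP (q_ z0) qz0.
  by case: (q z) (q_ z) => // *; rewrite ltry.
exists z; split => //.
have zr' : (`|p - z| < r)%R.
  rewrite lt_neqAle zr andbT; apply/eqP => /sphere.
  by rewrite ltNge (zmin z0 z0r).
apply: (@local_min_prox_subdiff _ _ _ _ (r - `|p - z|)%R) => //.
  by rewrite subr_gt0.
move=> w wz; apply: zmin => /=.
have -> : (p - w = (p - z) - (w - z))%R by rewrite opprB addrA subrK.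
by rewrite (le_trans (ler_normB _ _))//; lra.
Qed.

End convex_minorants.

(** * Affine minorants and the biconjugate *)

Section fenchel_moreau.
Context {R : realType} {n : nat}.
Implicit Types (q h : 'rV[R]_n -> \bar R) (p z w : 'rV[R]_n).

(** A proximal point of some z0 in the domain provides a subgradient. Without a
    lower bound on q the penalised function need not be coercive, so the
    minimisation is confined to the unit ball around z0. *)
Lemma affine_minorant_exists q : convex_fun q -> lower_semicontinuous q ->
  (forall z, -oo < q z) -> dom q !=set0 ->
  exists (u : 'rV[R]_n) (c : R), forall w, (dotv u w + c)%:E <= q w.
Proof.
move=> cq lq q_ [z0 qz0].
have [|m /= m1 mmin] := lsc_compact_min (@compact_closed_ball R n z0 1) _ lq.
  by exists z0; rewrite /= subrr normr0.
have [a qa] := ereal_realP (q_ z0) qz0.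
have [|b qb] := ereal_realP (q_ m).
  by rewrite (le_lt_trans (mmin z0 _))//= subrr normr0.
have ba : (b <= a)%R.
  by have := mmin z0; rewrite /= subrr normr0 qa qb lee_fin; exact.
(* At distance 1 the penalty k / 2 exceeds q z0 - min q by 1. *)
pose k : R := ((a - b + 1) * 2)%R.
have [||z [qz zu]] := @prox_point _ _ q z0 k 1 z0 cq lq q_ _ qz0.
- by rewrite subrr normr0.
- move=> w w1; rewrite subrr dotv0l mulr0 adde0.
  have := mmin w; rewrite /= w1 => /(_ (lexx _)) bw.
  apply: (@lt_le_trans _ _ (b%:E + (a - b + 1)%:E)).
    by rewrite qa -EFinD lte_fin; lra.
  rewrite leeD -?qb// lee_fin /k mulfK ?pnatr_eq0//.
  rewrite -[leLHS]mulr1 ler_wpM2l//; first by lra.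
  by have := sqr_norm_le_dotv (w - z0)%R; rewrite distrC w1 expr1n.
have [c qc] := ereal_realP (q_ z) qz.
exists (k *: (z0 - z))%R, (c - dotv (k *: (z0 - z)) z)%R => w.
have := zu w; rewrite qc; apply: le_trans.
by rewrite -EFinD lee_fin dotvBr; lra.
Qed.

(** For q >= 0 the penalised function is coercive, so p has a proximal point z
    for every k. The affine minorant supported at z takes at p the value
    q z + k |p - z|^2: if z is close to p the first term exceeds c by lower
    semicontinuity, otherwise the second one does once k is large. *)
Lemma nonneg_affine_approx q p (c : R) : convex_fun q ->
  lower_semicontinuous q -> (forall z, 0 <= q z) -> dom q !=set0 ->
  c%:E < q p ->
  exists (u : 'rV[R]_n) (b : R),
    (forall w, (dotv u w + b)%:E <= q w) /\ (c <= dotv u p + b)%R.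
Proof.
move=> cq lq q0 [z0 qz0] cqp.
have q_ z : -oo < q z by rewrite (lt_le_trans _ (q0 z)).
have [V /nbhs_ballP[d /= d0 dV] cV] := lq _ _ cqp.
(* Makes k |p - z|^2 larger than c as soon as |p - z| >= d. *)
pose k : R := ((`|c| + 1) * 2 / d ^+ 2)%R.
have k0 : (0 < k)%R by rewrite !mulr_gt0 ?invr_gt0 ?exprn_gt0// ltr_wpDl.
have [a qa] := ereal_realP (q_ z0) qz0.
have k2 : (0 < k / 2)%R by rewrite divr_gt0.
pose D := dotv (z0 - p) (z0 - p).
(* Since r >= 1, the penalty k / 2 r^2 on the sphere is at least k / 2 r,
   which exceeds the value a + k / 2 D of the penalised function at z0. *)
pose r : R := (`|p - z0| + (a + k / 2 * D + 1) / (k / 2) + 1)%R.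
have a0 : (0 <= a)%R by rewrite -lee_fin -qa.
have D0 : (0 <= k / 2 * D)%R by rewrite mulr_ge0 ?dotvv_ge0// divr_ge0// ltW.
have rX : (0 <= (a + k / 2 * D + 1) / (k / 2))%R.
  by apply: divr_ge0; [lra|rewrite divr_ge0// ltW].
have [||z [qz zu]] := @prox_point _ _ q p k r z0 cq lq q_ _ qz0.
- by rewrite /r; lra.
- move=> w wr; rewrite -/D qa.
  have r1 : (1 <= r)%R by rewrite /r; have := normr_ge0 (p - z0)%R; lra.
  apply: (@lt_le_trans _ _ (0 + (k / 2 * r)%:E)).
    rewrite add0e -EFinD lte_fin.
    rewrite [ltRHS]mulrC -ltr_pdivrMr// /r.
    rewrite (@lt_le_trans _ _ ((a + k / 2 * D + 1) / (k / 2))%R)//.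
      by rewrite ltr_pM2r ?invr_gt0// ltrDl.
    by have := normr_ge0 (p - z0)%R; lra.
  rewrite leeD// lee_fin ler_pM2l//.
  have := sqr_norm_le_dotv (w - p)%R; rewrite distrC wr; apply: le_trans.
  by rewrite expr2 ler_peMl//; lra.
have [s qs] := ereal_realP (q_ z) qz.
have s0 : (0 <= s)%R by rewrite -lee_fin -qs.
exists (k *: (p - z))%R, (s - dotv (k *: (p - z)) z)%R; split => [w|].
  have := zu w; rewrite qs; apply: le_trans.
  by rewrite -EFinD lee_fin dotvBr; lra.
rewrite addrCA -dotvBr dotvZl.
have pz0 := dotvv_ge0 (p - z)%R.
have [zd|zd] := ltP `|p - z|%R d.
  have : c%:E < q z by apply/cV/dV; rewrite -ball_normE.
  rewrite qs lte_fin => cs.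
  have : (0 <= k * dotv (p - z) (p - z))%R by rewrite mulr_ge0// ltW.
  lra.
have : (k * d ^+ 2 <= k * dotv (p - z) (p - z))%R.
  rewrite ler_pM2l//; apply: le_trans (sqr_norm_le_dotv _).
  by rewrite lerXn2r ?nnegrE// ltW.
rewrite {1}/k mulfVK ?expf_neq0 ?gt_eqF//.
have := ler_norm c; have := normr_ge0 c; lra.
Qed.

(** Subtracting an affine minorant reduces the claim to nonnegative functions. *)
Lemma affine_approx q p (c : R) : convex_fun q -> lower_semicontinuous q ->
  (forall z, -oo < q z) -> c%:E < q p ->
  exists (u : 'rV[R]_n) (b : R),
    (forall w, (dotv u w + b)%:E <= q w) /\ (c <= dotv u p + b)%R.
Proof.
move=> cq lq q_ cqp.
have [domq|domq] := pselect (dom q !=set0); last first.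
  exists 0%R, c; split => [w|]; last by rewrite dotv0l add0r.
  rewrite [q w](_ : _ = +oo) ?leey//; apply/eqP; rewrite -leye_eq leNgt.
  by apply/negP => qw; apply: domq; exists w.
have [u0 [b0 ub]] := affine_minorant_exists cq lq q_ domq.
pose q' z := q z + (dotv (- u0) z - b0)%:E.
have q'E z : q' z = q z - (dotv u0 z + b0)%:E.
  by rewrite /q' dotvNl -opprD EFinN.
have [|||||u [b [uq' cb]]] :=
    @nonneg_affine_approx q' p (c - (dotv u0 p + b0))%R.
- exact: convex_addr_affine.
- apply: lsc_addr_continuous => // z; apply: continuousB.
    exact: dotv_continuous.
  exact: cst_continuous.
- by move=> z; rewrite q'E sube_ge0 ?ub.
- case: domq => z qz; exists z.
  by rewrite /dom /= q'E -EFinN lte_add_pinfty ?ltry.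
- rewrite q'E EFinB; case: (q p) cqp => [s||].
  - by rewrite -!EFinB !lte_fin ltrD2r.
  - by move=> _; rewrite -EFinB -EFinN addye// ltry.
  - by rewrite ltNge leNye.
exists (u + u0)%R, (b + b0)%R; split => [w|].
  have := uq' w; rewrite q'E leeBrDr// -EFinD; congr (_%:E <= _).
  by rewrite dotvDl addrACA.
by rewrite dotvDl; lra.
Qed.

(** The hard half of the Fenchel-Moreau theorem: an affine minorant of q with
    slope u is one of h, so it lies below <u, .> - h^* u. *)
Lemma lsc_convex_le_biconj q h p : convex_fun q -> lower_semicontinuous q ->
  (forall z, -oo < q z) -> (forall z, q z <= h z) ->
  q p <= fconj (fconj h) p.
Proof.
move=> cq lq q_ qh; apply: le_ereal_lt_real => c cqp.
have [u [b [uq cb]]] := affine_approx cq lq q_ cqp.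
apply: (@le_trans _ _ ((dotv u p)%:E - fconj h u)); last first.
  exact: le_fconj.
have hu : fconj h u <= (- b)%:E.
  apply/fconj_leP => x; have := le_trans (uq x) (qh x).
  case: (h x) => [r||].
  - by rewrite -EFinB !lee_fin dotvC => ?; lra.
  - by rewrite leNye.
  - by rewrite leeNy_eq.
rewrite (@le_trans _ _ ((dotv u p)%:E + b%:E))//.
by rewrite leeD2l// leeNr.
Qed.

End fenchel_moreau.

(** * Convex hulls of functions *)

Section hulls.
Context {R : realType} {n : nat}.
Implicit Types (h : 'rV[R]_n -> \bar R) (x y : 'rV[R]_n) (X : set 'rV[R]_n).

Lemma convex_affine (u : 'rV[R]_n) (c : R) :
  convex_fun (fun z => (dotv u z + c)%:E).
Proof.
move=> x y t t01; rewrite -!EFinM -EFinD lee_fin dotvDr !dotvZr; lra.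
Qed.

Lemma lsc_affine (u : 'rV[R]_n) (c : R) :
  lower_semicontinuous (fun z : 'rV[R]_n => (dotv u z + c)%:E).
Proof.
have -> : (fun z : 'rV[R]_n => (dotv u z + c)%:E) =
    (fun z => cst c%:E z + (dotv u z)%:E).
  by apply/funext => z /=; rewrite -EFinD addrC.
apply: lsc_addr_continuous => [z||]; first by rewrite ltNyr.
  by move=> z a ac; exists setT => //; exact: filterT.
exact: dotv_continuous.
Qed.

(** Each function <x, .> - r with r >= h^* x is an affine minorant of h. Letting r
    vary also covers the case h^* x = -oo. *)
Lemma restr_biconj_le_closed_conv_hull X h y :
  fconj (restr X (fconj h)) y <= closed_conv_hull h y.
Proof.
apply/fconj_leP => x; rewrite /restr; case: ifPn => _; last first.
  by rewrite leNye.
apply: le_ereal_lt_real => c cF; pose r : R := (dotv x y - c)%R.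
have Fr : fconj h x <= r%:E.
  move: cF; case: (fconj h x) => [F||]; rewrite ?leNye//.
  by rewrite -EFinB lte_fin lee_fin /r => ?; lra.
apply: ereal_sup_ubound; exists (fun z => (dotv x z - r)%:E); last first.
  by rewrite /r opprB addrC subrK.
split=> [z|||z]; [by rewrite ltNyr|exact: convex_affine|exact: lsc_affine|].
have : (dotv z x)%:E - h z <= r%:E.
  exact: le_trans (le_fconj h z x) Fr.
case: (h z) => [b||]; rewrite ?leey// (dotvC z).
by rewrite -EFinB !lee_fin => ?; lra.
Qed.

Lemma closed_conv_hull_le_biconj h y :
  closed_conv_hull h y <= fconj (fconj h) y.
Proof.
by apply/ereal_supP => _ [q [q_ cq lq qh] <-]; exact: lsc_convex_le_biconj.
Qed.

Lemma closed_conv_hull_le_conv_hull h y : closed_conv_hull h y <= conv_hull h y.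
Proof.
apply/ereal_supP => _ [q [q_ cq _ qh] <-].
by apply: ereal_sup_ubound; exists q.
Qed.

Lemma conv_hull_le h y : conv_hull h y <= h y.
Proof. by apply/ereal_supP => _ [q [_ _ qh] <-]. Qed.

Lemma restr_setT h : restr setT h = h.
Proof. by apply/funext => x; rewrite /restr mem_set. Qed.

End hulls.

(** * Gradients and subgradients *)

Section gradients.
Context {R : realType} {n : nat}.
Implicit Types (h : 'rV[R]_n -> \bar R) (u v y z : 'rV[R]_n).

Lemma differentiable_small (F : 'rV[R]_n -> R^o) y (eps : R) :
  differentiable F y -> (0 < eps)%R ->
  exists2 d : R, (0 < d)%R & forall v, (`|v| < d)%R ->
    (`|F (y + v) - F y - 'd F y v| <= eps * `|v|)%R.
Proof.
move=> /diff_locally /eqaddoP /(_ _ _)/[apply] /nbhs_ballP[d /= d0 dP].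
exists d => // v vd.
have /dP : ball (0%R : 'rV[R]_n) d v by rewrite -ball_normE /= sub0r normrN.
have -> : ((F \o +%R^~ y - (cst (F y) + 'd F y)) v =
    F (y + v) - F y - 'd F y v)%R; last by [].
  by rewrite [(y + v)%R]addrC -addrA -opprD.
Qed.

Lemma dotv_linear u : linear (dotv u : 'rV[R]_n -> R^o).
Proof. by move=> k v w; rewrite dotvDr dotvZr. Qed.

HB.instance Definition _ u := GRing.isLinear.Build R 'rV[R]_n R^o _
  (dotv u : 'rV[R]_n -> R^o) (dotv_linear u).

Lemma diff_eq_dotv (F : 'rV[R]_n -> R^o) y u :
  (forall eps : R, (0 < eps)%R -> exists2 d : R, (0 < d)%R &
    forall v, (`|v| < d)%R ->
      (`|F (y + v) - F y - dotv u v| <= eps * `|v|)%R) ->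
  'd F y = dotv u :> ('rV[R]_n -> R^o).
Proof.
move=> H; apply: (@diff_unique R _ _ F (dotv u : {linear 'rV[R]_n -> R^o})).
  exact: dotv_continuous.
apply/eqaddoP => eps /H[d d0 dP].
apply/nbhs_ballP; exists d => //= v.
rewrite -ball_normE /= sub0r normrN => /dP.
have -> : ((F \o +%R^~ y - (cst (F y) + dotv u)) v =
    F (y + v) - F y - dotv u v)%R; last by [].
by rewrite [(y + v)%R]addrC -addrA -opprD.
Qed.

Lemma dotv_grad h y v :
  dotv (grad h y) v = 'd (fine \o h : 'rV[R]_n -> R^o) y v.
Proof.
rewrite {2}(row_sum_delta v) linear_sum dotvE; apply: eq_bigr => i _ /=.
by rewrite linearZ /= mxE mulrC.
Qed.

Lemma grad_eq h y u :
  'd (fine \o h : 'rV[R]_n -> R^o) y = dotv u :> ('rV[R]_n -> R^o) ->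
  grad h y = u.
Proof.
move=> hu; apply/eqP; rewrite -subr_eq0; apply/eqP/dotvv_eq0.
by rewrite dotvBl dotv_grad hu subrr.
Qed.

Lemma int_domP h y : int_dom h y <->
  exists2 d : R, (0 < d)%R & forall v, (`|v| < d)%R -> h (y + v)%R < +oo.
Proof.
split=> [/nbhs_ballP[d /= d0 dh]|[d d0 dh]].
  exists d => // v vd; apply: dh.
  by rewrite -ball_normE /= opprD addrA subrr sub0r normrN.
apply/nbhs_ballP; exists d => //= z; rewrite -ball_normE /= => yz.
by rewrite /dom /= -(subrKC y z); apply: dh; rewrite distrC.
Qed.

Lemma int_dom_sub h y : int_dom h y -> h y < +oo.
Proof. by move=> /interior_subset. Qed.

(** The chord from y to z lies above h, and its slope at y is at least the
    directional derivative. *)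
Lemma gradient_inequality h y : convex_fun h -> (forall z, -oo < h z) ->
  int_dom h y -> differentiable (fine \o h : 'rV[R]_n -> R^o) y ->
  fsubdiff h y (grad h y).
Proof.
move=> ch h_ yY dh z.
have [a hya] := ereal_realP (h_ y) (int_dom_sub yY).
have [->|/eqP hz] := eqVneq (h z) +oo; first by rewrite leey.
have [|b hzb] := ereal_realP (h_ z); first by rewrite ltey; exact/eqP.
rewrite hya hzb -EFinD lee_fin.
have N0 : (0 < `|z - y| + 1)%R by rewrite ltr_wpDl.
apply/ler_addgt0Pr => e e0.
have [d d0 dP] := differentiable_small dh (divr_gt0 e0 N0).
pose t : R := Num.min 1%R (d / (`|z - y| + 1) / 2)%R.
have t0 : (0 < t)%R by rewrite lt_min ltr01 !divr_gt0.
have t01 : (0 <= t <= 1)%R by rewrite ltW// ge_min lexx.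
have tz : (`|t *: (z - y)| < d)%R.
  rewrite normrZ gtr0_norm//.
  have td : (t * (`|z - y| + 1) <= d / 2)%R.
    by rewrite -ler_pdivlMr// mulrAC ge_min lexx orbT.
  have tN : (t * `|z - y| <= t * (`|z - y| + 1))%R by rewrite ler_pM2l// lerDl.
  lra.
have := dP _ tz; rewrite -dotv_grad /= hya /= dotvZr.
have := convex_segment y z ch t01; rewrite hya hzb.
have [|c hc] := ereal_realP (h_ (y + t *: (z - y))%R).
  rewrite (le_lt_trans (convex_segment y z ch t01))// hya hzb.
  by rewrite -!EFinM -EFinD ltry.
rewrite hc -!EFinM -EFinD lee_fin /= => cab.
rewrite ler_norml => /andP[+ _]; rewrite normrZ gtr0_norm// => ce.
have : (e / (`|z - y| + 1) * (t * `|z - y|) <= t * e)%R.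
  rewrite mulrCA ler_pM2l// -mulrA ler_piMr ?(ltW e0)//.
  by rewrite mulrC ler_pdivrMr// mul1r lerDl.
set E := (e / _ * _)%R in ce *; set G := dotv _ _ in ce * => Ee.
suff : (t * (a + G) <= t * (b + e))%R by rewrite ler_pM2l.
lra.
Qed.

(** With v the difference of the two vectors, h grows along v at least like
    <u, v> and at most like <grad h y, v> + o(v), which forces |v|^2 = o(v). *)
Lemma subgradient_eq_grad h y u : (forall z, -oo < h z) ->
  int_dom h y -> differentiable (fine \o h : 'rV[R]_n -> R^o) y ->
  fsubdiff h y u -> u = grad h y.
Proof.
move=> h_ yY dh hu; apply/eqP; rewrite -subr_eq0 -normr_eq0.
have [d1 d10 d1P] := (int_domP h y).1 yY.
have [a hya] := ereal_realP (h_ y) (int_dom_sub yY).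
set v := (u - grad h y)%R; apply/eqP; apply: contrapT => /eqP v0'.
have v0 : (0 < `|v|)%R by rewrite lt_def v0' normr_ge0.
have [|d2 d20 d2P] := @differentiable_small _ _ (`|v| / 2)%R dh.
  by rewrite divr_gt0.
pose t : R := (Num.min d1 d2 / 2 / `|v|)%R.
have m0 : (0 < Num.min d1 d2)%R by rewrite lt_min d10.
have t0 : (0 < t)%R by rewrite !divr_gt0.
have tv : (`|t *: v| = Num.min d1 d2 / 2)%R.
  by rewrite normrZ gtr0_norm// mulfVK// gt_eqF.
have tvm : (`|t *: v| < Num.min d1 d2)%R by rewrite tv; lra.
move: tvm; rewrite lt_min => /andP[/d1P + /d2P].
move=> /(ereal_realP (h_ _))[c hc].
rewrite -dotv_grad /= hc hya /= ler_norml => /andP[_].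
have := hu (y + t *: v)%R; rewrite hc hya addrAC subrr add0r -EFinD lee_fin.
rewrite !dotvZr normrZ gtr0_norm// => H1 H2.
have : (t * dotv v v <= t * (`|v| / 2 * `|v|))%R.
  by rewrite {1}/v dotvBl; lra.
rewrite ler_pM2l//; have := sqr_norm_le_dotv v; rewrite expr2.
have := mulr_gt0 v0 v0; lra.
Qed.

Lemma fconj_subgradient h y u (a : R) : h y = a%:E -> fsubdiff h y u ->
  fconj h u = (dotv y u - a)%:E.
Proof.
move=> hya hu; apply/eqP; rewrite eq_le; apply/andP; split; last first.
  by rewrite EFinB -hya le_fconj.
apply/fconj_leP => x; have := hu x; rewrite hya -EFinD.
case: (h x) => [r||].
- by rewrite -EFinB !lee_fin dotvBr !(dotvC u) => ?; lra.
- by rewrite leNye.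
- by rewrite leeNy_eq.
Qed.

Lemma fconj_gtNy h z u : h z < +oo -> -oo < fconj h u.
Proof.
move=> hz; apply: (@lt_le_trans _ _ ((dotv z u)%:E - h z)).
  by case: (h z) hz => // r _; rewrite ltNyr.
exact: le_fconj.
Qed.

End gradients.

(** * The Bregman envelope, proximal map and hull *)

Section bregman_envelope.
Context {R : realType} {n : nat}.
Variables (phi : 'rV[R]_n -> \bar R) (hphi : dgf phi).
Variables (g : 'rV[R]_n -> \bar R) (lam : R) (lam0 : (0 < lam)%R).
Implicit Types (x y z xi : 'rV[R]_n).

Local Notation X := (dom phi).
Local Notation Y := (int_dom phi).

(** Called the dual sum below; [epi_comp phi g] is g_(grad phi). *)
Definition epi_sum xi := fconj phi xi + lam%:E * epi_comp phi g xi.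

(** The value that y contributes to the dual sum at grad phi y; the dual sum is
    the infimum of these values over the fibre of grad phi. *)
Definition grad_sum y := fconj phi (grad phi y) + lam%:E * g y.

Lemma dgf_gtNy x : -oo < phi x.
Proof. by case: hphi => -[]. Qed.

Lemma dgf_subgradient y : Y y -> fsubdiff phi y (grad phi y).
Proof.
case: hphi => -[phi_ _] _ cphi [_ dphi] yY.
by apply: gradient_inequality => //; exact: dphi.
Qed.

Lemma dgf_conj_grad y : Y y -> exists a b : R,
  [/\ phi y = a%:E, fconj phi (grad phi y) = b%:E
    & b = (dotv y (grad phi y) - a)%R].
Proof.
move=> yY; have [a pa] := ereal_realP (dgf_gtNy y) (int_dom_sub yY).
exists a, (dotv y (grad phi y) - a)%R; split=> //.
exact: fconj_subgradient (dgf_subgradient yY).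
Qed.

(** The Bregman distance is a Fenchel-Young gap. *)
Lemma scaled_bregman_term x y (r b : R) (A : \bar R) : Y y -> phi x = r%:E ->
  fconj phi (grad phi y) = b%:E ->
  lam%:E * (A + lam^-1%:E * bregman phi x y) =
  lam%:E * A + (r + b - dotv x (grad phi y))%:E.
Proof.
move=> yY pr; have [a [b' [pa -> ->]]] := dgf_conj_grad yY => -[bE].
rewrite /bregman mem_set// pr pa -!EFinB.
rewrite muleDr ?fin_num_adde_defl// -!EFinM mulVKf ?gt_eqF// -bE.
by congr (_ + _%:E); rewrite dotvBr !(dotvC (grad phi y)); lra.
Qed.

(** Lower bounds on the dual sum can be tested on Y: on the range of grad phi the
    conjugate is real and passes through the infimum, elsewhere the sum is +oo
    because phi^* never takes the value -oo. *)
Lemma le_epi_sumP (c : \bar R) xi :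
  c <= epi_sum xi <-> (forall y, Y y -> grad phi y = xi -> c <= grad_sum y).
Proof.
split=> [ch y yY yxi|cH].
  apply: le_trans ch _; rewrite /epi_sum /grad_sum yxi leeD2l// lee_pmul2l//.
  by apply: ereal_inf_lbound; exists y.
have [[y0 y0Y y0xi]|no] := pselect (exists2 y, Y y & grad phi y = xi).
  have [a [b [_ pb _]]] := dgf_conj_grad y0Y.
  have bfin : b%:E \is a fin_num by [].
  rewrite /epi_sum -y0xi pb -(leeBlDl _ _ bfin) -(lee_pdivrMl _ _ lam0).
  rewrite /epi_comp; apply/ereal_infP => _ [y [yY yxi] <-].
  rewrite (lee_pdivrMl _ _ lam0) (leeBlDl _ _ bfin) -pb -yxi.
  exact: (cH y yY (etrans yxi y0xi)).
rewrite /epi_sum /epi_comp (_ : [set _ | _] = set0) ?image_set0 ?ereal_inf0.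
  rewrite gt0_muley ?lte_fin// addey ?leey// -ltNye.
  by case: hphi => -[_ [z /fconj_gtNy]].
by apply/seteqP; split=> // y [yY yxi]; apply: no; exists y.
Qed.

(** Both sides have the same lower bounds c: by [le_epi_sumP] each condition says
    <x, grad phi y> - phi x + c <= grad_sum y for all y in Y. *)
Lemma scaled_right_env x : X x ->
  lam%:E * right_env phi lam g x = phi x - fconj epi_sum x.
Proof.
move=> xX; have [r pr] := ereal_realP (dgf_gtNy x) xX.
apply: eq_ereal_le => c; rewrite -lee_pdivrMl//.
have swap (s : R) (K : \bar R) :
    (s%:E - K <= r%:E - c) = ((s - r)%:E + c <= K).
  case: c K => [c||] [K||] //=; rewrite ?leey ?leNye//.
  by rewrite -!EFinB -!EFinD !lee_fin; apply/idP/idP => ?; lra.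
have swap' (s b : R) (K : \bar R) :
    ((s - r)%:E + c <= b%:E + K) = (c <= K + (r + b - s)%:E).
  case: c K {swap} => [c||] [K||] //=; rewrite ?leey ?leNye//.
  by rewrite -!EFinD !lee_fin; apply/idP/idP => ?; lra.
split=> [/ereal_infP cenv|cfconj].
  suff : fconj epi_sum x <= r%:E - c.
    rewrite pr; case: (fconj epi_sum x) c {swap swap' cenv} => [K||] [c||] //=;
      rewrite ?leey ?leNye// -!EFinB !lee_fin => ?; lra.
  apply/fconj_leP => xi; rewrite (dotvC xi) swap.
  apply/le_epi_sumP => y yY <-; have [a [b [_ pb _]]] := dgf_conj_grad yY.
  rewrite /grad_sum pb swap' -(scaled_bregman_term _ yY pr pb) -lee_pdivrMl//.
  by apply: cenv; exists y.
apply/ereal_infP => _ [y yY <-]; have [a [b [_ pb _]]] := dgf_conj_grad yY.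
rewrite lee_pdivrMl// (scaled_bregman_term _ yY pr pb) -swap'.
rewrite -pb; apply: (le_epi_sumP _ _).1 => //; rewrite -swap.
apply: (@le_trans _ _ (fconj epi_sum x)).
  by rewrite dotvC; exact: le_fconj.
move: cfconj; rewrite pr; case: (fconj epi_sum x) c {swap swap'} => [K||] [c||] //=;
  rewrite ?leey ?leNye// -!EFinB !lee_fin => ?; lra.
Qed.

(** Optimality of y, written without phi x so that it can be compared with the
    subgradient inequality of the dual sum in [subdiff_invP]. *)
Lemma right_proxP x y : X x -> right_prox phi lam g x y <->
  Y y /\ forall z, Y z ->
    grad_sum y + (dotv x (grad phi z - grad phi y))%:E <= grad_sum z.
Proof.
move=> xX; have [r pr] := ereal_realP (dgf_gtNy x) xX.
suff termP z : Y y -> Y z ->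
    (g y + lam^-1%:E * bregman phi x y <= g z + lam^-1%:E * bregman phi x z) =
    (grad_sum y + (dotv x (grad phi z - grad phi y))%:E <= grad_sum z).
  by split=> -[yY ymin]; split=> // z zY; [rewrite -termP|rewrite termP];
    rewrite //; exact: ymin.
move=> yY zY; have [a [b [_ pb _]]] := dgf_conj_grad yY.
have [a' [b' [_ pb' _]]] := dgf_conj_grad zY.
rewrite -(@lee_pmul2l _ lam%:E)// (scaled_bregman_term _ yY pr pb).
rewrite (scaled_bregman_term _ zY pr pb') /grad_sum.
generalize dependent (grad phi y); generalize dependent (grad phi z).
move=> ez pb' ey pb; rewrite pb pb' dotvBr.
case: (lam%:E * g y) => [A||]; case: (lam%:E * g z) => [B||];
  rewrite ?leey ?leNye// -!EFinD !lee_fin.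
by apply/idP/idP => ?; lra.
Qed.

Lemma epi_sum_attained y : Y y -> g y = epi_comp phi g (grad phi y) ->
  epi_sum (grad phi y) = grad_sum y.
Proof. by rewrite /epi_sum /grad_sum => _ <-. Qed.

Lemma subdiff_invP x y : Y y -> g y = epi_comp phi g (grad phi y) ->
  fsubdiff_inv epi_sum x (grad phi y) <->
  forall z, Y z -> grad_sum y + (dotv x (grad phi z - grad phi y))%:E <= grad_sum z.
Proof.
move=> yY gy; rewrite /fsubdiff_inv /fsubdiff /= (epi_sum_attained yY gy).
split=> [sub z zY|sub xi].
  by apply: le_trans (sub (grad phi z)) _; apply: (le_epi_sumP _ _).1.
by apply/le_epi_sumP => z zY <-; exact: sub.
Qed.

(** Among points with the same gradient the Bregman distance to x is constant,
    so a proximal point minimises g on its fibre. *)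
Lemma right_prox_attained x y : X x -> right_prox phi lam g x y ->
  g y = epi_comp phi g (grad phi y).
Proof.
move=> xX /(right_proxP _ xX)[yY ymin].
have [a [b [_ pb _]]] := dgf_conj_grad yY.
apply/eqP; rewrite eq_le; apply/andP; split; last first.
  by apply: ereal_inf_lbound; exists y.
apply/ereal_infP => _ [z [zY zy] <-].
have := ymin z zY; rewrite zy subrr dotvC dotv0l adde0 /grad_sum zy pb.
have lamfin : lam%:E \is a fin_num by [].
by move=> {ymin}; rewrite leeD2lE ?(lee_pmul2l lamfin _)// lte_fin.
Qed.

Lemma grad_right_prox x : X x ->
  grad phi @` right_prox phi lam g x =
  fsubdiff_inv epi_sum x `&` epi_comp_attained phi g.
Proof.
move=> xX; apply/seteqP; split=> [_ [y yp <-]|xi [sub [y [yY yxi gy]]]].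
  have gy := right_prox_attained xX yp.
  have [yY ymin] := (right_proxP _ xX).1 yp.
  by split; [exact/subdiff_invP|exists y].
subst xi; exists y => //; apply/(right_proxP _ xX); split=> //.
exact/(subdiff_invP _ yY gy).
Qed.

(** A xi outside the range of grad phi has dual sum +oo, and a subgradient there
    would make the dual sum +oo everywhere, contrary to g being finite or -oo
    at some point of Y. *)
Lemma subdiff_inv_attained x : (exists2 y, Y y & g y < +oo) ->
  (forall y, Y y -> epi_comp_attained phi g (grad phi y)) ->
  fsubdiff_inv epi_sum x `<=` epi_comp_attained phi g.
Proof.
move=> [y0 y0Y gy0] att xi sub.
have [[y yY <-]|no] := pselect (exists2 y, Y y & grad phi y = xi).
  exact: att.
have hxi : epi_sum xi = +oo.
  apply/eqP; rewrite -leye_eq; apply/le_epi_sumP => y yY yxi.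
  by exfalso; apply: no; exists y.
have := sub (grad phi y0); rewrite /= hxi addye// leye_eq => /eqP hy0.
have /(le_epi_sumP _ _).1/(_ y0 y0Y erefl) : +oo <= epi_sum (grad phi y0).
  by rewrite hy0.
have [a [b [_ pb _]]] := dgf_conj_grad y0Y.
rewrite /grad_sum pb leye_eq; case: (g y0) gy0 => //= _.
by rewrite gt0_muleNy ?lte_fin.
Qed.

Lemma scaled_right_hull y : Y y -> lam%:E * right_hull phi lam g y =
  fconj (restr X (fconj epi_sum)) (grad phi y) - fconj phi (grad phi y).
Proof.
move=> yY; have [a [b [pa pb bE]]] := dgf_conj_grad yY.
rewrite /right_hull muleN; apply/esym/oppe_inj; rewrite oppeK.
apply/esym/eq_ereal_le => c.
have termP x : X x -> (lam^-1%:E * c <=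
    - right_env phi lam g x + lam^-1%:E * bregman phi x y) =
    ((dotv x (grad phi y))%:E - fconj epi_sum x <= - c + b%:E).
  move=> xX; have [r pr] := ereal_realP (dgf_gtNy x) xX.
  rewrite lee_pdivrMl// (scaled_bregman_term _ yY pr pb) muleN.
  rewrite scaled_right_env// pr.
  case: (fconj epi_sum x) c => [K||] [c||]; rewrite ?leey ?leNye//=.
  by rewrite -?EFinB -?EFinN -?EFinD !lee_fin; apply/idP/idP => ?; lra.
rewrite leeNr pb leeBlDr// -lee_pdivrMl//.
split=> [/ereal_infP cenv|/fconj_leP cconj].
  apply/fconj_leP => x; rewrite /restr; case: ifPn => [|_].
    by rewrite inE => xX; rewrite -termP//; apply: cenv; exists x.
  by rewrite leNye.
apply/ereal_infP => _ [x xX <-]; rewrite termP//.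
by have := cconj x; rewrite /restr mem_set.
Qed.

End bregman_envelope.

(** * Conjugates of essentially strictly convex functions *)

Section legendre_duality.
Context {R : realType} {n : nat}.
Implicit Types (phi : 'rV[R]_n -> \bar R) (x y z v xi : 'rV[R]_n).

Lemma subdiff_fin phi x xi : (forall z, -oo < phi z) -> dom phi !=set0 ->
  fsubdiff phi x xi -> exists a : R, phi x = a%:E.
Proof.
move=> phi_ [z phiz] xxi; apply: ereal_realP => //.
have := xxi z; case: (phi x) => [r _||]; rewrite ?ltry ?ltNyr//.
by rewrite addye// leye_eq => /eqP phiz'; move: phiz; rewrite /dom /= phiz'.
Qed.

(** It is the set of minimisers of the convex function phi - <xi, .>. *)
Lemma convex_subdiff_inv phi xi : (forall z, -oo < phi z) ->
  convex_fun phi -> dom phi !=set0 ->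
  convex_set [set x | fsubdiff phi x xi].
Proof.
move=> phi_ cphi dphi x y t; rewrite !inE /= => xxi yxi.
have [a pa] := subdiff_fin phi_ dphi xxi.
have [b pb] := subdiff_fin phi_ dphi yxi.
have t01 : (0 <= t%:num <= 1)%R by rewrite ge0 le1.
have := cphi x y t%:num t01; rewrite pa pb; set s := (t%:num)%R in t01 *.
set m := (_ *: x + _)%R => mab.
have [|c pc] := ereal_realP (phi_ m).
  by rewrite (le_lt_trans mab)// -!EFinM -EFinD ltry.
move=> w; change (phi m + (dotv xi (w - m))%:E <= phi w).
have := xxi w; have := yxi w; move: mab; rewrite pa pb pc -!EFinM -!EFinD.
case: (phi w) (phi_ w) => [d||]// _; last by move=> *; rewrite leey.
rewrite !lee_fin !dotvBr /m dotvDr !dotvZr.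
set A := dotv xi w; set B := dotv xi y; set C := dotv xi x => H1 H2 H3.
have : (s * (a + (A - C)) <= s * d)%R by rewrite ler_wpM2l//; lra.
have : ((1 - s) * (b + (A - B)) <= (1 - s) * d)%R by rewrite ler_wpM2l//; lra.
lra.
Qed.

(** The solution set is a convex part of the domain of the subdifferential on
    which phi is affine, so strict convexity leaves at most one point. *)
Lemma subdiff_inv_unique phi xi x y : (forall z, -oo < phi z) ->
  convex_fun phi -> dom phi !=set0 -> essentially_strictly_convex phi ->
  fsubdiff phi x xi -> fsubdiff phi y xi -> x = y.
Proof.
move=> phi_ cphi dphi sc xxi yxi; apply: contrapT => xy.
have [a pa] := subdiff_fin phi_ dphi xxi.
have [b pb] := subdiff_fin phi_ dphi yxi.
have half : (0 < (2^-1 : R) < 1)%R by lra.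
have := sc _ (convex_subdiff_inv (xi := xi) phi_ cphi dphi)
  (fun z zxi => ex_intro _ xi zxi) x y _ xxi yxi xy half.
set m := (_ *: x + _)%R; rewrite pa pb -!EFinM -EFinD => mlt.
have := xxi y; rewrite pa pb -EFinD lee_fin.
have := yxi x; rewrite pa pb -EFinD lee_fin.
have := le_lt_trans (xxi m) mlt; rewrite pa -EFinD lte_fin.
by rewrite !dotvBr /m dotvDr !dotvZr; lra.
Qed.

(** On the sphere of radius d the gap phi - phi x - <xi, . - x> is lower
    semicontinuous and, x being the only minimiser, positive, so it is bounded
    below by some e > 0. Convexity along rays from x propagates this to the
    rate e / d outside the ball. *)
Lemma subdiff_linear_growth phi xi x (d : R) : (forall z, -oo < phi z) ->
  convex_fun phi -> lower_semicontinuous phi -> dom phi !=set0 ->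
  essentially_strictly_convex phi -> fsubdiff phi x xi -> (0 < d)%R ->
  exists2 c : R, (0 < c)%R & forall w, (d <= `|w - x|)%R ->
    phi x + (dotv xi (w - x) + c * `|w - x|)%:E <= phi w.
Proof.
move=> phi_ cphi lphi dphi sc xxi d0.
have [a pa] := subdiff_fin phi_ dphi xxi.
pose S : set 'rV[R]_n :=
  [set w | `|x - w| <= d]%R `&` [set w | d <= `|x - w|]%R.
have project w (t := (d / `|w - x|)%R) : (d <= `|w - x|)%R ->
    [/\ (0 < t <= 1)%R, (t * `|w - x| = d)%R & S (x + t *: (w - x))%R].
  move=> dw; have w0 : (0 < `|w - x|)%R by exact: lt_le_trans dw.
  have t0 : (0 < t)%R by rewrite divr_gt0.
  have td : (t * `|w - x| = d)%R by rewrite /t mulfVK// gt_eqF.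
  split=> //; first by rewrite t0 ler_pdivrMr// mul1r.
  by rewrite /S /= opprD addrA subrr sub0r normrN normrZ gtr0_norm// td lexx.
have cS : compact S.
  apply: compact_closedI; first exact: compact_closed_ball.
  rewrite (_ : [set w | _] = ~` ball x d); first exact/open_closedC/ball_open.
  by apply/seteqP; split=> w; rewrite -ball_normE /= leNgt => /negP.
have [S0|S0] := pselect (S !=set0); last first.
  exists 1%R => // w /project[_ _ Sw]; exfalso; apply: S0.
  by eexists; exact: Sw.
pose F w := phi w + (dotv (- xi) w)%:E.
have lF : lower_semicontinuous F.
  by apply: lsc_addr_continuous => //; exact: dotv_continuous.
have [m Sm mmin] := lsc_compact_min cS S0 lF.
have mx : m <> x.
  by move=> mx; case: Sm; rewrite mx /= subrr normr0 => _; rewrite leNgt d0.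
have gap : (a + dotv (- xi) x)%:E < F m.
  rewrite ltNge; apply/negP => Fm; apply: mx.
  apply: (subdiff_inv_unique phi_ cphi dphi sc _ xxi) => w.
  have := xxi w; rewrite pa; move: Fm; rewrite /F.
  case: (phi m) (phi_ m) => [b||]// _.
  rewrite -!EFinD lee_fin => Hb; apply: le_trans; rewrite lee_fin.
  by move: Hb; rewrite !dotvBr !dotvNl; lra.
have [e e0 eF] : exists2 e : R, (0 < e)%R & (a + dotv (- xi) x + e)%:E <= F m.
  move: gap; case: (F m) => [f||//]; last by exists 1%R; rewrite ?leey.
  rewrite lte_fin => af; exists (f - (a + dotv (- xi) x))%R.
    by rewrite subr_gt0.
  by rewrite lee_fin subrKC.
exists (e / d)%R; first by rewrite divr_gt0.
move=> w /project[/andP[t0 t1] td Sw].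
set t := (d / `|w - x|)%R in t0 t1 td Sw *.
have t01 : (0 <= t <= 1)%R by rewrite ltW.
have := convex_segment x w cphi t01.
have := le_trans eF (mmin _ Sw); rewrite /F pa.
case: (phi w) (phi_ w) => [b||]// _; last by rewrite leey.
rewrite -!EFinM -!EFinD.
case: (phi (x + _)%R) (phi_ (x + t *: (w - x))%R) => [f||]// _.
rewrite -?EFinD !lee_fin dotvDr dotvZr !dotvNl => H1 H2.
suff : (t * (a + (dotv xi (w - x) + e / d * `|w - x|)) <= t * b)%R.
  by rewrite ler_pM2l.
have -> : (t * (a + (dotv xi (w - x) + e / d * `|w - x|)) =
    t * a + t * dotv xi (w - x) + e)%R.
  rewrite !mulrDr addrA; congr (_ + _)%R.
  by rewrite mulrCA td mulfVK// gt_eqF.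
lra.
Qed.

(** The lower bound phi^* (xi + v) >= phi^* xi + <x, v> is immediate. For the
    upper bound, points w near x contribute an error <w - x, v> of size
    eps |v|, and for small v linear growth prevents the others from competing. *)
Lemma grad_fconj_subdiff phi xi x : (forall z, -oo < phi z) ->
  convex_fun phi -> lower_semicontinuous phi -> dom phi !=set0 ->
  essentially_strictly_convex phi -> fsubdiff phi x xi ->
  int_dom (fconj phi) xi /\ grad (fconj phi) xi = x.
Proof.
move=> phi_ cphi lphi dphi sc xxi.
have [a pa] := subdiff_fin phi_ dphi xxi.
have conj0 : fconj phi xi = (dotv x xi - a)%:E by exact: fconj_subgradient.
have low v : (dotv x (xi + v) - a)%:E <= fconj phi (xi + v)%R.
  by rewrite EFinB -pa; exact: le_fconj.
have N0 : (0 < n%:R + 1 :> R)%R by rewrite ltr_wpDl.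
have up (eps : R) : (0 < eps)%R -> exists2 d : R, (0 < d)%R & forall v,
    (`|v| < d)%R ->
    fconj phi (xi + v)%R <= (dotv x (xi + v) - a + eps * `|v|)%:E.
  move=> e0; pose r : R := (eps / (n%:R + 1))%R.
  have r0 : (0 < r)%R by rewrite divr_gt0.
  have [c c0 growth] := subdiff_linear_growth phi_ cphi lphi dphi sc xxi r0.
  exists (c / (n%:R + 1))%R; first by rewrite divr_gt0.
  move=> v vc; apply/fconj_leP => w.
  have dotle : (dotv (w - x) v <= (n%:R + 1) * `|w - x| * `|v|)%R.
    rewrite (le_trans (ler_norm _))// (le_trans (normr_dotv_le _ _))//.
    by rewrite ler_wpM2r// ler_wpM2r// lerDl.
  have [wr|wr] := ltP `|w - x|%R r.
    have := xxi w; rewrite pa -EFinD.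
    case: (phi w) (phi_ w) => [b||]// _; last by rewrite leNye.
    rewrite -EFinB !lee_fin dotvBr => Hb.
    have : ((n%:R + 1) * `|w - x| * `|v| <= eps * `|v|)%R.
      by rewrite ler_wpM2r// mulrC -ler_pdivlMr// ltW.
    move: dotle; rewrite dotvBl !dotvDr !(dotvC xi) in Hb *; lra.
  have := growth _ wr; rewrite pa -EFinD.
  case: (phi w) (phi_ w) => [b||]// _; last by rewrite leNye.
  rewrite -EFinB !lee_fin dotvBr => Hb.
  have : ((n%:R + 1) * `|w - x| * `|v| <= c * `|w - x|)%R.
    rewrite mulrAC ler_wpM2r// mulrC -ler_pdivlMr//; exact: ltW.
  have : (0 <= eps * `|v|)%R by rewrite mulr_ge0// ltW.
  move: dotle; rewrite dotvBl !dotvDr !(dotvC xi) in Hb *; lra.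
split.
  have [d d0 dP] := up 1%R ltr01; apply/int_domP; exists d => // v /dP.
  by move=> /le_lt_trans; apply; rewrite ltry.
apply/grad_eq/diff_eq_dotv => eps /up[d d0 dP]; exists d => // v /dP.
have := low v; rewrite /= conj0; case: (fconj phi (xi + v)%R) => [b||].
- rewrite !lee_fin /= !dotvDr => lo hi; rewrite ler_norml.
  have : (0 <= eps * `|v|)%R by lra.
  by move=> ev; apply/andP; split; lra.
- by rewrite [_ <= _%:E]leye_eq.
- by rewrite leeNy_eq.
Qed.

End legendre_duality.

(** * Domain and range of the subdifferential *)

Section subdifferential_domain.
Context {R : realType} {n : nat}.
Implicit Types (phi : 'rV[R]_n -> \bar R) (x y z v xi : 'rV[R]_n).

Definition axis (s : R) (i : 'I_n) : 'rV[R]_n := (s *: delta_mx ord0 i)%R.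

Lemma dotv_axis x s i : dotv x (axis s i) = (s * x ord0 i)%R.
Proof.
rewrite /axis dotvZr dotvE (bigD1 i)//= mxE !eqxx mulr1 big1 ?addr0// => j ji.
by rewrite mxE (negPf ji) andbF mulr0.
Qed.

Lemma norm_axis_le s i : (`|axis s i| <= `|s|)%R.
Proof.
apply: norm_le_coord => // j; rewrite !mxE normrM ler_piMr//.
by case: (_ && _); rewrite ?normr1 ?normr0.
Qed.

(** Finitely many test vectors control the sup norm, so a bound on linear forms
    is needed at finitely many points only. *)
Lemma norm_le_axes x (s C : R) : (0 < s)%R -> (0 <= C)%R ->
  (forall i, dotv x (axis s i) <= C)%R ->
  (forall i, dotv x (axis (- s) i) <= C)%R -> (`|x| <= C / s)%R.
Proof.
move=> s0 C0 xp xm; apply: norm_le_coord; first by rewrite divr_ge0// ltW.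
move=> i; rewrite ler_pdivlMr// mulrC -{1}(gtr0_norm s0) -normrM.
have := xp i; have := xm i; rewrite !dotv_axis mulNr => H1 H2.
by rewrite ler_norml; apply/andP; split; lra.
Qed.

(** Finiteness of phi^* at the points xi + axis (+-s) i bounds phi - <xi, .> below
    by s |.| minus a constant; a minimiser then exists by compactness. *)
Lemma subdiff_inv_exists phi xi : (forall z, -oo < phi z) ->
  lower_semicontinuous phi -> dom phi !=set0 -> int_dom (fconj phi) xi ->
  exists x, fsubdiff phi x xi.
Proof.
move=> phi_ lphi [z0 z0dom] /int_domP[d d0 dP].
have [a pa] := ereal_realP (phi_ z0) z0dom.
have conj_real v : (`|v| < d)%R -> exists b : R, fconj phi (xi + v)%R = b%:E.
  by move=> /dP; apply: ereal_realP; exact: fconj_gtNy z0dom.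
pose s : R := (d / 2)%R.
have s0 : (0 < s)%R by rewrite divr_gt0.
have axis_lt t i : (`|t| = s)%R -> (`|axis t i| < d)%R.
  move=> ts; rewrite (le_lt_trans (norm_axis_le _ _))// ts /s; lra.
(* By the Fenchel-Young inequality at xi + v, c v bounds <w, v> up to the
   term phi w - <xi, w>. *)
pose c v : R := `|fine (fconj phi (xi + v)%R)|%R.
have cP v w (b : R) : (`|v| < d)%R -> phi w = b%:E ->
    (dotv w v <= b - dotv xi w + c v)%R.
  move=> /conj_real[e fe] pw; have := le_fconj phi w (xi + v)%R.
  rewrite fe pw -EFinB lee_fin /c fe /= dotvDr (dotvC xi w).
  by have := ler_norm e; lra.
pose M : R := (c 0 + \sum_i (c (axis s i) + c (axis (- s) i)))%R.
have cM0 : (c 0 <= M)%R.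
  by rewrite lerDl sumr_ge0// => i _; rewrite addr_ge0 ?normr_ge0.
have cM i : (c (axis s i) + c (axis (- s) i) <= M)%R.
  rewrite /M (bigD1 i)//= addrCA lerDl addr_ge0 ?normr_ge0// sumr_ge0// => j _.
  by rewrite addr_ge0 ?normr_ge0.
have coercive w (b : R) : phi w = b%:E -> (`|w| <= (b - dotv xi w + M) / s)%R.
  move=> pw; apply: norm_le_axes => //.
  - have := cP 0%R w b; rewrite normr0 dotvC dotv0l => /(_ d0 pw); lra.
  - move=> i; have := cP _ _ _ (axis_lt s i (gtr0_norm s0)) pw.
    have := cM i; have : (0 <= c (axis (- s) i))%R by exact: normr_ge0.
    lra.
  - have sN : (`|- s| = s)%R by rewrite normrN gtr0_norm.
    move=> i; have := cP _ _ _ (axis_lt _ i sN) pw.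
    have := cM i; have : (0 <= c (axis s i))%R by exact: normr_ge0.
    lra.
pose F w := phi w + (dotv (- xi) w)%:E.
have lF : lower_semicontinuous F.
  by apply: lsc_addr_continuous => //; exact: dotv_continuous.
pose r : R := ((a - dotv xi z0 + M) / s)%R.
have [|m /= mr mmin] := lsc_compact_min (@compact_closed_ball R n 0%R r) _ lF.
  by exists z0; rewrite /= sub0r normrN; exact: coercive.
have z0r : (`|0 - z0| <= r)%R by rewrite sub0r normrN; exact: coercive.
exists m => w.
suff : F m <= F w.
  rewrite /F; have := mmin _ z0r; rewrite /F pa.
  case: (phi m) (phi_ m) => [b||]// _; case: (phi w) (phi_ w) => [e||]// _ _.
  - by rewrite -!EFinD !lee_fin dotvBr !dotvNl => ?; lra.
  - by move=> *; rewrite leey.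
have [wr|rw] := leP (`|0 - w|)%R r; first exact: mmin.
apply: le_trans (mmin _ z0r) _; rewrite /F pa.
case: (phi w) (phi_ w) (coercive w) => [e||]// _; last by rewrite addye// leey.
move=> /(_ e erefl); move: rw; rewrite sub0r normrN => /lt_le_trans/[apply].
by rewrite ltr_pM2r ?invr_gt0// -!EFinD lee_fin !dotvNl => ?; lra.
Qed.

(** Suppose x is not interior and approach it along the segment from an interior
    point y0. The gradients G at these points stay bounded: monotonicity against
    the subgradient xi at x bounds <G, y0 - x> below, and then the subgradient
    inequality evaluated on a ball around y0, where phi is bounded, bounds
    <G, v> above for all small v. This contradicts essential smoothness. *)
Lemma subdiff_int_dom phi x xi : (forall z, -oo < phi z) -> convex_fun phi ->
  essentially_smooth phi -> fsubdiff phi x xi -> int_dom phi x.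
Proof.
move=> phi_ cphi [[[y0 y0Y] dphi] smooth] xxi; apply: contrapT => xY.
have [d d0 dP] := (int_domP phi y0).1 y0Y.
have [|a pa] := subdiff_fin phi_ _ xxi.
  by exists y0; exact: int_dom_sub.
pose w := (y0 - x)%R.
pose t (k : nat) : R := (k.+1%:R^-1)%R.
have t0 k : (0 < t k)%R by rewrite invr_gt0.
have t1 k : (t k <= 1)%R by rewrite invf_le1 ?ler1n.
pose u k := (x + t k *: w)%R.
have uY k : int_dom phi (u k).
  apply/int_domP; exists (t k * d)%R; first by rewrite mulr_gt0.
  move=> v vd; have : (`|(t k)^-1 *: v| < d)%R.
    by rewrite normrZ gtr0_norm ?invr_gt0// mulrC ltr_pdivrMr// mulrC.
  move=> /dP /(ereal_realP (phi_ _))[b pb].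
  have -> : (u k + v = x + t k *: (y0 + (t k)^-1 *: v - x))%R.
    rewrite /u /w -addrA; congr (_ + _)%R.
    have -> : (y0 + (t k)^-1 *: v - x = w + (t k)^-1 *: v)%R by rewrite addrAC.
    by rewrite [RHS]scalerDr scalerA divff ?scale1r// gt_eqF.
  apply: le_lt_trans (convex_segment _ _ cphi _) _.
    by rewrite (ltW (t0 k)) t1.
  by rewrite pa pb -!EFinM -EFinD ltry.
have u_cvg : u @ \oo --> x.
  rewrite -[X in _ --> X]addr0 -(scale0r w).
  apply: cvgD; first exact: cvg_cst.
  by apply: cvgZr_tmp; exact: cvg_harmonic.
have bounded : exists B : R, forall k, (`|grad phi (u k)| <= B)%R.
  have [e e0 eP] := differentiable_small (dphi _ y0Y) ltr01.
  have [b pb] := ereal_realP (phi_ y0) (int_dom_sub y0Y).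
  pose r := (Num.min d e / 2)%R.
  have m0 : (0 < Num.min d e)%R by rewrite lt_min d0.
  have r0 : (0 < r)%R by rewrite divr_gt0.
  (* Differentiability at y0 bounds phi on the ball of radius r around y0. *)
pose M : R := (b + (n%:R * `|grad phi y0| + 1) * r)%R.
  have MP v : (`|v| <= r)%R -> phi (y0 + v)%R <= M%:E.
    move=> vr; have : (`|v| < Num.min d e)%R.
      by rewrite (le_lt_trans vr)// /r; lra.
    rewrite lt_min => /andP[/dP + /eP].
    move=> /(ereal_realP (phi_ _))[c pc]; rewrite /= pb pc /= -dotv_grad.
    rewrite ler_norml mul1r lee_fin /M => /andP[_ H1].
    have H2 := le_trans (ler_norm _) (normr_dotv_le (grad phi y0) v).
    have H3 : ((n%:R * `|grad phi y0| + 1) * `|v| <=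
        (n%:R * `|grad phi y0| + 1) * r)%R.
      by rewrite ler_wpM2l// addr_ge0// mulr_ge0.
    lra.
  pose l := dotv xi w; pose C : R := (M - a + 2 * `|l|)%R.
  have key k v : (`|v| <= r)%R -> (dotv (grad phi (u k)) v <= C)%R.
    move=> /MP pv; set G := grad phi (u k).
    have Gsub : fsubdiff phi (u k) G.
      by apply: gradient_inequality => //; exact: dphi.
    have [c pc] := ereal_realP (phi_ (u k)) (int_dom_sub (uY k)).
    have := Gsub x; rewrite pc pa -EFinD lee_fin.
    have -> : (x - u k = - (t k *: w))%R by rewrite /u opprD addrA subrr sub0r.
    have := xxi (u k); rewrite pc pa -EFinD lee_fin.
    have -> : (u k - x = t k *: w)%R by rewrite /u addrAC subrr add0r.
    have := le_trans (Gsub _) pv; rewrite pc -EFinD lee_fin.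
    have -> : (y0 + v - u k = (1 - t k) *: w + v)%R.
      rewrite /u scalerBl scale1r opprD [RHS]addrAC addrA; congr (_ + _)%R.
      by rewrite addrAC.
    rewrite dotvDr dotvNr !dotvZr -/l => H1 H2 H3.
    have lG : (l <= dotv G w)%R by rewrite -(ler_pM2l (t0 k)); lra.
    have H4 : ((1 - t k) * l <= (1 - t k) * dotv G w)%R.
      by rewrite ler_wpM2l// subr_ge0.
    have := ler_norm (- l); rewrite normrN /C => H5.
    have := normr_ge0 l; lra.
  exists (C / r)%R => k; apply: norm_le_axes => //.
  - have := key k 0%R; rewrite normr0 dotvC dotv0l => -> //; exact: ltW.
  - move=> i; apply: key; rewrite (le_trans (norm_axis_le _ _))//.
    by rewrite gtr0_norm.
  - move=> i; apply: key; rewrite (le_trans (norm_axis_le _ _))//.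
    by rewrite normrN gtr0_norm.
have [B GB] := bounded.
have xbdry : (closure (dom phi) `\` int_dom phi) x.
  by split=> //; apply: subset_closure; rewrite /dom /= pa ltry.
have /cvgryPgt/(_ B) := smooth _ _ uY xbdry u_cvg.
case=> N _ /(_ N (leqnn N)) /=; rewrite ltNge GB//.
Qed.

End subdifferential_domain.

(** * Legendre functions *)

Section legendre_gradient.
Context {R : realType} {n : nat}.
Variables (phi : 'rV[R]_n -> \bar R) (hphi : dgf phi) (lphi : legendre phi).
Implicit Types (g : 'rV[R]_n -> \bar R) (x y xi : 'rV[R]_n).

Lemma legendre_grad_conjK y : int_dom phi y ->
  int_dom (fconj phi) (grad phi y) /\ grad (fconj phi) (grad phi y) = y.
Proof.
move=> yY; case: (hphi) => -[phi_ dphi] lsc_phi cphi _.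
apply: grad_fconj_subdiff => //; first by case: lphi.
exact: dgf_subgradient.
Qed.

Lemma legendre_grad_surj xi : int_dom (fconj phi) xi ->
  exists2 y, int_dom phi y & grad phi y = xi.
Proof.
case: (hphi) => -[phi_ dphi] lsc_phi cphi [_ diffphi] xiY.
have [y ysub] := subdiff_inv_exists phi_ lsc_phi dphi xiY.
have yY : int_dom phi y by apply: subdiff_int_dom ysub => //; case: lphi.
by exists y => //; rewrite (subgradient_eq_grad phi_ yY (diffphi _ yY) ysub).
Qed.

(** Fibres of grad phi are singletons. *)
Lemma legendre_epi_attained g :
  epi_comp_attained phi g = int_dom (fconj phi).
Proof.
apply/seteqP; split=> [_ [y [yY <- _]]|xi /legendre_grad_surj[y yY <-]].
  exact: (legendre_grad_conjK yY).1.
exists y; split => //; rewrite /epi_comp.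
rewrite (_ : [set _ | _] = [set y]) ?image_set1 ?ereal_inf1//.
apply/seteqP; split=> [z [zY zy] /=|_ ->//].
by rewrite -(legendre_grad_conjK zY).2 zy (legendre_grad_conjK yY).2.
Qed.

Lemma legendre_comp_grad_conj g : comp_grad_conj phi g = epi_comp phi g.
Proof.
apply/funext => xi; rewrite /comp_grad_conj; case: ifPn => [|/negP no].
  rewrite inE => xiY; have := xiY; rewrite -(legendre_epi_attained g).
  by move=> [y [yY yxi <-]]; rewrite -yxi (legendre_grad_conjK yY).2.
rewrite /epi_comp (_ : [set _ | _] = set0) ?image_set0 ?ereal_inf0//.
apply/seteqP; split=> // y [yY yxi]; apply: no; rewrite inE -yxi.
exact: (legendre_grad_conjK yY).1.
Qed.

Lemma legendre_right_prox g (lam : R) x : (0 < lam)%R -> dom phi x ->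
  right_prox phi lam g x = grad (fconj phi) @`
    (fsubdiff_inv (fun xi => fconj phi xi + lam%:E * comp_grad_conj phi g xi) x
      `&` int_dom (fconj phi)).
Proof.
move=> lam0 xX; rewrite legendre_comp_grad_conj -(legendre_epi_attained g).
rewrite -grad_right_prox// image_comp.
apply/seteqP; split=> [y yp|_ [y yp <-]].
  exists y => //=; apply: (legendre_grad_conjK _).2; exact: yp.1.
by rewrite /= (legendre_grad_conjK yp.1).2.
Qed.

End legendre_gradient.

(** * Envelope, proximal map and hull through the dual sum *)

Theorem lemma3p19 (R : realType) (n : nat) (phi : 'rV[R]_n -> \bar R)
    (hphi : dgf phi) (g : 'rV[R]_n -> \bar R) (lam : R) (hlam : (0 < lam)%R) :
  let X := dom phi in
  let Y := int_dom phi in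
  let h := fun xi => fconj phi xi + lam%:E * epi_comp phi g xi in
  let hL := fun xi => fconj phi xi + lam%:E * comp_grad_conj phi g xi in
  (* (i) *)
  [/\ forall x, X x -> lam%:E * right_env phi lam g x = phi x - fconj h x,
  (* (ii) *)
      [/\ forall x, X x ->
            grad phi @` right_prox phi lam g x =
            fsubdiff_inv h x `&` epi_comp_attained phi g,
          (exists2 y, Y y & g y < +oo) ->
          (forall y, Y y -> epi_comp_attained phi g (grad phi y)) ->
          forall x, X x ->
            grad phi @` right_prox phi lam g x = fsubdiff_inv h x
        & legendre phi -> forall x, X x ->
            right_prox phi lam g x =
            grad (fconj phi) @` (fsubdiff_inv hL x `&` int_dom (fconj phi))]
  (* (iii) *)
    & (forall y, Y y ->
        [/\ lam%:E * right_hull phi lam g y =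
              fconj (restr X (fconj h)) (grad phi y) - fconj phi (grad phi y),
            fconj (restr X (fconj h)) (grad phi y) - fconj phi (grad phi y) <=
              closed_conv_hull h (grad phi y) - fconj phi (grad phi y),
            closed_conv_hull h (grad phi y) - fconj phi (grad phi y) <=
              conv_hull h (grad phi y) - fconj phi (grad phi y)
          & conv_hull h (grad phi y) - fconj phi (grad phi y) <=
              lam%:E * g y]) /\
      (X = setT -> forall y, Y y ->
        fconj (restr X (fconj h)) (grad phi y) - fconj phi (grad phi y) =
        closed_conv_hull h (grad phi y) - fconj phi (grad phi y))].
Proof.
move=> X Y h hL.
have hull y : Y y ->
  [/\ lam%:E * right_hull phi lam g y =
        fconj (restr X (fconj h)) (grad phi y) - fconj phi (grad phi y),
      fconj (restr X (fconj h)) (grad phi y) <= closed_conv_hull h (grad phi y),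
      closed_conv_hull h (grad phi y) <= conv_hull h (grad phi y)
    & conv_hull h (grad phi y) - fconj phi (grad phi y) <= lam%:E * g y].
  move=> yY; split; [exact: scaled_right_hull|
    exact: restr_biconj_le_closed_conv_hull|
    exact: closed_conv_hull_le_conv_hull|].
  have [a [b [_ pb _]]] := dgf_conj_grad hphi yY.
  have bfin : b%:E \is a fin_num by [].
  rewrite pb (leeBlDl _ _ bfin) -pb.
  apply: (le_trans (conv_hull_le _ _)).
  exact: (le_epi_sumP hphi g hlam _ _).1 (lexx _) y yY erefl.
split; [|split|split].
- by move=> x xX; exact: scaled_right_env.
- by move=> x xX; exact: grad_right_prox.
- move=> fin att x xX; rewrite grad_right_prox//; apply/setIidPl.
  exact: subdiff_inv_attained.
- by move=> leg x xX; exact: legendre_right_prox.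
- move=> y yY; have [hullE le1 le2 le3] := hull y yY.
  by split=> //; apply: leeB.
- move=> XT y yY; congr (_ - _); apply/eqP; rewrite eq_le.
  rewrite restr_biconj_le_closed_conv_hull /= XT restr_setT.
  exact: closed_conv_hull_le_biconj.
Qed.
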